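(* Let $q$ be a prime power, $m,n,k,\rho$ positive integers, let $\mathcal{C}$ be a nondegenerate $[n,k]_{q^m/q}$ rank-metric code and let $\mathcal{U}$ be an $[n,k]_{q^m/q}$ system associated with $\mathcal{C}$. Then $\mathcal{U}$ is rank-$\rho$-saturating if and only if $\rho_{\mathrm{rk}}(\mathcal{C}^\perp)=\rho$.
   Context: An $[n,k]_{q^m/q}$ code is a $k$-dimensional $\mathbb{F}_{q^m}$-subspace of $\mathbb{F}_{q^m}^{1\times n}$; a generator matrix is a $k\times n$ matrix over $\mathbb{F}_{q^m}$ whose rows form a basis. It is nondegenerate if the $\mathbb{F}_q$-span of the columns of a generator matrix has $\mathbb{F}_q$-dimension $n$. A system associated with $\mathcal{C}$ is the $\mathbb{F}_q$-span of the columns of a generator matrix of $\mathcal{C}$. The dual is $\mathcal{C}^\perp=\{v\in\mathbb{F}_{q^m}^{1\times n}: \sum_j v_jc_j=0\ \forall c\in\mathcal{C}\}$. Rank weight: $\mathrm{wt}_{\mathrm{rk}}(x)=\dim_{\mathbb{F}_q}\langle x_1,\ldots,x_n\rangle_{\mathbb{F}_q}$; rank distance $d_{\mathrm{rk}}(x,y)=\mathrm{wt}_{\mathrm{rk}}(x-y)$. The rank covering radius of a code $\mathcal{D}\le\mathbb{F}_{q^m}^{1\times n}$ is $\rho_{\mathrm{rk}}(\mathcal{D})=\max_{x\in\mathbb{F}_{q^m}^{1\times n}}\min_{c\in\mathcal{D}} d_{\mathrm{rk}}(x,c)$. An $[n,k]_{q^m/q}$ system is an $n$-dimensional $\mathbb{F}_q$-subspace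 $\mathcal{U}\le\mathbb{F}_{q^m}^k$ with $\langle\mathcal{U}\rangle_{\mathbb{F}_{q^m}}=\mathbb{F}_{q^m}^k$; its linear set is $L_\mathcal{U}=\{\langle u\rangle_{\mathbb{F}_{q^m}}: u\in\mathcal{U}\setminus\{0\}\}\subseteq\mathrm{PG}(k-1,q^m)$. A set $\mathcal{S}$ of points of $\mathrm{PG}(k-1,q^m)$ is $r$-saturating if every point lies in the projective subspace spanned by some $r+1$ points of $\mathcal{S}$ and $r$ is the smallest such integer. $\mathcal{U}$ is rank-$\rho$-saturating if $L_\mathcal{U}$ is $(\rho-1)$-saturating. *)

(* Defs.v *)
From HB Require Import structures.
From mathcomp Require Export all_boot all_order all_fingroup all_algebra all_solvable all_field.

Set Implicit Arguments.
Unset Strict Implicit.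
Unset Printing Implicit Defensive.

Export GRing.Theory.
Local Open Scope ring_scope.

(* F plays the role of F_q and L that of F_{q^m}. The field L is finite, but as *)
(* a fieldExtType it carries no canonical finType structure; [finvect_type L]   *)
(* is convertible to L and does, so it is used for finite ranges of L-vectors.  *)
(* 'rV[L]_n and 'cV[L]_k are vector spaces over L only. The space L^k seen over *)
(* F is {ffun 'I_k -> L}, and [colv] identifies it with 'cV[L]_k.               *)

Section RankMetric.
Variables (F : finFieldType) (L : fieldExtType F).

Definition colv (k : nat) (u : {ffun 'I_k -> L}) : 'cV[L]_k := \col_i u i.

Definition generator_mx (n k : nat) (C : {vspace 'rV[L]_n}) (G : 'M[L]_(k, n)) :=
  basis_of C [seq row i G | i <- enum 'I_k].

Definition col_span (n k : nat) (G : 'M[L]_(k, n)) : {vspace {ffun 'I_k -> L}} :=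
  <<[seq [ffun i => G i j] | j <- enum 'I_n]>>%VS.

Definition nondegenerate (n : nat) (C : {vspace 'rV[L]_n}) : Prop :=
  exists2 G : 'M[L]_(\dim C, n), generator_mx C G & \dim (col_span G) = n.

Definition associated_system (n k : nat) (C : {vspace 'rV[L]_n})
    (U : {vspace {ffun 'I_k -> L}}) : Prop :=
  exists2 G : 'M[L]_(k, n), generator_mx C G & U = col_span G.

(* The second condition says that the L-span of U, i.e. the least L-subspace    *)
(* containing U, is the whole space.                                            *)
Definition is_system (n k : nat) (U : {vspace {ffun 'I_k -> L}}) : Prop :=
  \dim U = n /\
  forall W : {vspace 'cV[L]_k}, {in U, forall u, colv u \in W} -> W = fullv.

Definition dual_code (n : nat) (C : {vspace 'rV[L]_n}) : {vspace 'rV[L]_n} :=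
  (\bigcap_(c : 'rV[finvect_type L]_n | (c : 'rV[L]_n) \in C)
     lker (linfun (fun v : 'rV[L]_n => (\sum_j v 0 j * c 0 j : L^o)%R)))%VS.

Lemma mem_dual_code (n : nat) (C : {vspace 'rV[L]_n}) (v : 'rV[L]_n) :
  v \in dual_code C <->
  forall c : 'rV[L]_n, c \in C -> \sum_j v 0 j * c 0 j = 0.
Proof.
have dotE (c : 'rV[L]_n) :
    (v \in lker (linfun (fun w : 'rV[L]_n => (\sum_j w 0 j * c 0 j : L^o))))
    = (\sum_j v 0 j * c 0 j == 0).
  pose f (w : 'rV[L]_n) : L^o := \sum_j w 0 j * c 0 j.
  have lin_f : linear f.
    move=> a x y; rewrite /f scaler_sumr -big_split /=; apply: eq_bigr => j _.
    by rewrite !mxE mulrDl -mulrA.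
  pose fM := GRing.isLinear.Build _ _ _ _ f lin_f.
  pose fL : {linear 'rV[L]_n -> L^o} := HB.pack f fM.
  by rewrite memv_ker -[LHS]/(linfun fL v == 0) lfunE.
rewrite memvE /dual_code; split=> [/subv_bigcapP vC c cC|vC].
  by apply/eqP; rewrite -dotE memvE; apply: vC.
by apply/subv_bigcapP => c cC; rewrite -memvE dotE vC.
Qed.

Definition rk_weight (n : nat) (x : 'rV[L]_n) : nat :=
  \dim <<[seq (x 0 j)%R | j <- enum 'I_n]>>%VS.

Definition rk_dist (n : nat) (x y : 'rV[L]_n) : nat := rk_weight (x - y).

Definition rk_dist_code (n : nat) (D : {vspace 'rV[L]_n}) (x : 'rV[L]_n) : nat :=
  rk_dist x [arg min_(c < (0 : 'rV[finvect_type L]_n) | (c : 'rV[L]_n) \in D)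
               rk_dist x c].

Definition rk_covering_radius (n : nat) (D : {vspace 'rV[L]_n}) : nat :=
  (\max_(x : 'rV[finvect_type L]_n) rk_dist_code D x)%N.

(* A point of PG(k - 1, q^m) is a subspace P of 'cV[L]_k with \dim P = 1.       *)
Definition linear_set (k : nat) (U : {vspace {ffun 'I_k -> L}})
    (P : {vspace 'cV[L]_k}) : Prop :=
  exists u, [/\ u \in U, u != 0 & P = <[colv u]>%VS].

Definition points_covered (k r : nat) (S : {vspace 'cV[L]_k} -> Prop) : Prop :=
  forall P : {vspace 'cV[L]_k}, \dim P = 1%N ->
    exists s : seq {vspace 'cV[L]_k},
      [/\ uniq s, size s = r.+1, {in s, forall Q, S Q}
        & (P <= \sum_(Q <- s) Q)%VS].

Definition saturating (k r : nat) (S : {vspace 'cV[L]_k} -> Prop) : Prop :=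
  points_covered r S /\ forall r', points_covered r' S -> (r <= r')%N.

(* Meaningful for rho > 0 only. *)
Definition rank_saturating (k rho : nat) (U : {vspace {ffun 'I_k -> L}}) : Prop :=
  saturating rho.-1 (linear_set U).

End RankMetric.

(* Main.v *)
Require Import Defs.

Set Implicit Arguments.
Unset Strict Implicit.
Unset Printing Implicit Defensive.

(* Let G be a generator matrix of C whose columns span U. A vector y of rank    *)
(* weight at most r factors as y = a B with a in L^r and B an r x n matrix over *)
(* F, so its syndrome G y^T = (G B^T) a^T is an L-combination of r vectors of U;*)
(* conversely, every L-combination of r vectors of U arises in this way. Since  *)
(* cosets of the dual code correspond to syndromes and every syndrome occurs,   *)
(* the covering radius of the dual code is the least r such that every vector   *)
(* of L^k is an L-combination of r vectors of U. As the linear set of U spans,  *)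
(* it contains k independent points, so that r <= k and any covering family of  *)
(* at most r points of the linear set can be completed to exactly r distinct    *)
(* points.                                                                      *)

Local Open Scope ring_scope.

(** Both invariants are thresholds for the predicate [spanned_by U r]. On the coding side,
    [dual_covering_radius_leP] rests on the two factorisations [syndrome_spanned] and
    [spanned_syndrome], with [mem_dual_syndrome] giving the kernel of the syndrome map and
    [generator_row_free] its surjectivity. On the geometric side, [points_covered_spanned] and
    [spanned_points_covered] pass between points of the linear set and vectors of [U]. *)

Section VectorSpaces.
Variables (K : fieldType) (vT : vectType K).
Implicit Types s X : seq vT.

Lemma exists_free_subseq X :
  exists s, [/\ subseq s X, free s & <<s>>%VS = <<X>>%VS].
Proof.
elim: X => [|v X [s [sX fs defX]]]; first by exists [::]; rewrite nil_free.
have [vX|vX] := boolP (v \in <<X>>%VS).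
  exists s; split=> //; first exact: subseq_trans sX (subseq_cons _ _).
  by rewrite span_cons defX; apply/esym/addv_idPr; rewrite -memvE.
exists (v :: s); split; first by rewrite /= eqxx.
  by rewrite free_cons defX vX.
by rewrite !span_cons defX.
Qed.

Lemma uniq_free_lines s : free s -> uniq [seq <[v]>%VS | v <- s].
Proof.
elim: s => //= v s IHs; rewrite free_cons => /andP[vs fs]; rewrite IHs // andbT.
apply: contra vs => /mapP[w ws vw].
by rewrite memvE vw -memvE memv_span.
Qed.

End VectorSpaces.

Section PaddingSequences.
Variable T : eqType.

(** Append to [s] the elements of [E] it lacks and cut at length [r]; [s] survives as a prefix. *)
Lemma uniq_complete (s E : seq T) r : uniq s -> uniq E ->
    (size s <= r <= size E)%N ->
  exists t, [/\ uniq t, size t = r, {subset s <= t} & {subset t <= s ++ E}].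
Proof.
move=> us uE /andP[sr rE]; pose w := s ++ [seq x <- E | x \notin s].
have uw : uniq w.
  rewrite cat_uniq us filter_uniq // andbT; apply/hasPn => x.
  by rewrite mem_filter => /andP[].
have rw : (r <= size w)%N.
  apply: (leq_trans rE); apply: uniq_leq_size => // x xE.
  by rewrite mem_cat mem_filter xE andbT orbN.
exists (take r w); split; first exact: take_uniq.
- exact: size_takel.
- by move=> x xs; rewrite /w take_cat ltnNge sr /= mem_cat xs.
move=> x /mem_take; rewrite !mem_cat mem_filter => /orP[-> //|/andP[_ ->]].
exact: orbT.
Qed.

End PaddingSequences.

Section Covering.
Variables (F : finFieldType) (L : fieldExtType F).

(** Bounding the size, with repeated and zero vectors allowed, makes this monotone in [r], like an
    upper bound on a rank weight. *)
Definition spanned_by (k : nat) (U : {vspace {ffun 'I_k -> L}}) (r : nat)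
    (v : 'cV[L]_k) : Prop :=
  exists t : seq {ffun 'I_k -> L},
    [/\ (size t <= r)%N, {subset t <= U} & v \in <<[seq colv u | u <- t]>>%VS].

Lemma colv_eq0 k (u : {ffun 'I_k -> L}) : (colv u == 0) = (u == 0).
Proof.
apply/eqP/eqP => [/matrixP u0|->]; last by apply/colP=> i; rewrite !mxE ffunE.
by apply/ffunP=> i; have := u0 i 0; rewrite !mxE ffunE.
Qed.

Lemma mem_col_spanP n k (G : 'M[L]_(k, n)) (u : {ffun 'I_k -> L}) :
  u \in col_span G <->
  exists a : 'I_n -> F, forall i, u i = \sum_j a j *: G i j.
Proof.
pose X := [tuple ([ffun i => G i j] : {ffun 'I_k -> L}) | j < n].
have nthX (j : 'I_n) : X`_j = [ffun i => G i j].
  by rewrite -tnth_nth tnth_mktuple.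
have -> : col_span G = <<X>>%VS by [].
split=> [uX|[a defu]].
  exists (fun j => coord X j u) => i; rewrite {1}(coord_span uX) sum_ffunE.
  by apply: eq_bigr => j _; rewrite nthX !ffunE.
have -> : u = \sum_j a j *: X`_j.
  apply/ffunP=> i; rewrite defu sum_ffunE.
  by apply: eq_bigr => j _; rewrite nthX !ffunE.
by apply: memv_suml => j _; rewrite memvZ // memv_span // mem_nth // size_tuple.
Qed.

(** Expand the entries of [y] in an F-basis [b] of their span: the coordinates, lying in F, combine
    columns of [G] into vectors of [U], and [b] supplies the L-coefficients. *)
Lemma syndrome_spanned n k (G : 'M[L]_(k, n)) (y : 'rV[L]_n) :
  spanned_by (col_span G) (rk_weight y) (G *m y^T).
Proof.
pose Y := <<[seq (y 0 j)%R | j <- enum 'I_n]>>%VS; pose b := vbasis Y.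
pose u (l : 'I_(\dim Y)) : {ffun 'I_k -> L} :=
  [ffun i => \sum_j coord b l (y 0 j) *: G i j].
exists [seq u l | l <- enum 'I_(\dim Y)]; split.
- by rewrite size_map size_enum_ord.
- move=> _ /mapP[l _ ->]; apply/mem_col_spanP.
  by exists (fun j => coord b l (y 0 j)) => i; rewrite ffunE.
have -> : G *m y^T = \sum_(l < \dim Y) b`_l *: colv (u l).
  apply/colP=> i; rewrite summxE mxE.
  under [RHS]eq_bigr => l _ do rewrite !mxE ffunE mulr_sumr.
  rewrite exchange_big; apply: eq_bigr => j _ /=; rewrite mxE.
  have yY : y 0 j \in Y by rewrite memv_span // map_f // mem_enum.
  rewrite {1}(coord_basis (vbasisP Y) yY) mulr_sumr; apply: eq_bigr => l _.
  by rewrite -scalerAr -scalerAr mulrC.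
apply: memv_suml => l _; rewrite memvZ // memv_span // map_f // map_f //.
by rewrite mem_enum.
Qed.

Lemma spanned_syndrome n k (G : 'M[L]_(k, n)) r (v : 'cV[L]_k) :
  spanned_by (col_span G) r v ->
  exists2 y : 'rV[L]_n, G *m y^T = v & (rk_weight y <= r)%N.
Proof.
case=> t [tr tU vt]; pose X := [tuple of [seq colv u | u <- in_tuple t]].
have vX : v \in <<X>>%VS by [].
pose a l := coord X l v.
have [c defc] : exists c : 'I_(size t) -> 'I_n -> F,
    forall (l : 'I_(size t)) i, t`_l i = \sum_j c l j *: G i j.
  pose P (l : 'I_(size t)) c := forall i, t`_l i = \sum_j c j *: G i j.
  by apply: (fin_all_exists (P := P)) => l; apply/mem_col_spanP/tU/mem_nth.
(* Every entry is an F-combination of the [size t] scalars [a l], which bounds the rank weight. *)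
exists (\row_j \sum_l c l j *: a l).
  apply/colP=> i; rewrite [in RHS](coord_span vX) summxE mxE.
  under eq_bigr => j _ do rewrite !mxE mulr_sumr.
  rewrite exchange_big; apply: eq_bigr => l _ /=.
  rewrite (nth_map 0) // !mxE defc mulr_sumr; apply: eq_bigr => j _.
  by rewrite -scalerAr -scalerAr mulrC.
apply: leq_trans tr; rewrite -[leqRHS]size_enum_ord -(size_map a).
apply: leq_trans (dim_span _); apply/dimvS/span_subvP => _ /mapP[j _ ->].
rewrite mxE; apply: memv_suml => l _.
by rewrite memvZ // memv_span // map_f // mem_enum.
Qed.

Lemma generator_row_free n k (C : {vspace 'rV[L]_n}) (G : 'M[L]_(k, n)) :
  generator_mx C G -> row_free G.
Proof.
move=> /andP[_ fG]; apply: inj_row_free => w; rewrite mulmx_sum_row => w0.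
have /freeP fX : free [tuple row i G | i < k] by [].
apply/rowP=> i; rewrite mxE; apply: (fX (fun i => w 0 i)).
by rewrite -[RHS]w0; apply: eq_bigr => l _; rewrite -tnth_nth tnth_mktuple.
Qed.

Lemma mem_dual_syndrome n k (C : {vspace 'rV[L]_n}) (G : 'M[L]_(k, n))
    (v : 'rV[L]_n) :
  generator_mx C G -> v \in dual_code C <-> G *m v^T = 0.
Proof.
move=> /andP[/eqP defC _]; split=> [/mem_dual_code vC|Gv].
  apply/colP=> i; rewrite !mxE -[RHS](vC (row i G)).
    by apply: eq_bigr => j _; rewrite !mxE mulrC.
  by rewrite -defC memv_span // (map_f (fun i => row i G)) // mem_enum.
apply/mem_dual_code => c.
have dotE (w : 'rV[L]_n) : \sum_j v 0 j * w 0 j = (w *m v^T) 0 0.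
  by rewrite mxE; apply: eq_bigr => j _; rewrite mxE mulrC.
have {}defC : C = <<[tuple row i G | i < k]>>%VS by rewrite -defC.
rewrite dotE defC => /coord_span ->; rewrite mulmx_suml summxE big1 // => i _.
rewrite -tnth_nth tnth_mktuple -scalemxAl -row_mul Gv row0 scaler0.
by rewrite mxE.
Qed.

Lemma rk_covering_radius_leP n (D : {vspace 'rV[L]_n}) r :
  (rk_covering_radius D <= r)%N <->
  forall x : 'rV[L]_n, exists2 c, c \in D & (rk_dist x c <= r)%N.
Proof.
have distP (x : 'rV[L]_n) :
    (rk_dist_code D x <= r)%N <-> exists2 c, c \in D & (rk_dist x c <= r)%N.
  rewrite /rk_dist_code; case: arg_minnP => [|c cD cmin]; first exact: mem0v.
  split=> [cr|[c' c'D c'r]]; first by exists c.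
  exact: leq_trans (cmin c' c'D) c'r.
split=> [/bigmax_leqP Dr x|Dr]; first exact/distP/(Dr x).
by apply/bigmax_leqP => x _; apply/distP/Dr.
Qed.

Lemma dual_covering_radius_leP n k (C : {vspace 'rV[L]_n})
    (G : 'M[L]_(k, n)) r :
  generator_mx C G ->
  (rk_covering_radius (dual_code C) <= r)%N <->
  forall v, spanned_by (col_span G) r v.
Proof.
move=> genG; split=> [/rk_covering_radius_leP Dr v|Ur].
  (* A right inverse of [G] exhibits [v] as the syndrome of [(B *m v)^T]. *)
  have [B GB] := row_freeP (generator_row_free genG).
  have [c cD cr] := Dr (B *m v)^T.
  have [t [tw tU vt]] := syndrome_spanned G ((B *m v)^T - c).
  exists t; split=> //; first exact: leq_trans tw cr.
  move: vt; rewrite linearB /= trmxK mulmxBr mulmxA GB mul1mx.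
  by rewrite (proj1 (mem_dual_syndrome c genG) cD) subr0.
apply/rk_covering_radius_leP => x.
(* [y] has the syndrome of [x] but small weight, so [x - y] is a dual codeword close to [x]. *)
have [y Gy yr] := spanned_syndrome (Ur (G *m x^T)).
exists (x - y); last by rewrite /rk_dist subKr.
by apply/(mem_dual_syndrome _ genG); rewrite linearB /= mulmxBr Gy subrr.
Qed.

(** The L-span of an F-basis of [U] contains [U], hence is everything; thin this basis to an
    L-basis. *)
Lemma system_basis n k (U : {vspace {ffun 'I_k -> L}}) : is_system n U ->
  exists t : seq {ffun 'I_k -> L},
    {subset t <= U} /\ basis_of fullv [seq colv u | u <- t].
Proof.
case=> _ spanU; pose X := [seq colv u | u <- vbasis U].
have spanX : <<X>>%VS = fullv.
  apply: spanU => u /(coord_basis (vbasisP U)) ->.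
  have -> : colv (\sum_i coord (vbasis U) i u *: (vbasis U)`_i)
      = \sum_i (coord (vbasis U) i u)%:A *: colv (vbasis U)`_i.
    apply/colP=> i; rewrite mxE sum_ffunE summxE; apply: eq_bigr => j _.
    by rewrite !mxE ffunE mulr_algl.
  apply: memv_suml => i _; rewrite memvZ // memv_span // map_f // mem_nth //.
  by rewrite size_tuple.
have [s [/subseqP[msk _ defs] fs spans]] := exists_free_subseq X.
exists (mask msk (vbasis U)); split; first by move=> u /mem_mask/vbasis_mem.
by rewrite map_mask -defs /basis_of spans spanX eqxx.
Qed.

Lemma size_basis_cV k (s : seq 'cV[L]_k) : basis_of fullv s -> size s = k.
Proof.
move=> bs; have := size_basis (X := in_tuple s) bs.
by rewrite dimvf /dim /= muln1.
Qed.

Lemma system_spanned n k (U : {vspace {ffun 'I_k -> L}}) (v : 'cV[L]_k) :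
  is_system n U -> spanned_by U k v.
Proof.
move/system_basis=> [t [tU bt]]; exists t; split=> //.
  by rewrite -(size_map (@colv F L k)) (size_basis_cV bt).
by rewrite (span_basis bt) memvf.
Qed.

Lemma system_points n k (U : {vspace {ffun 'I_k -> L}}) : is_system n U ->
  exists E : seq {vspace 'cV[L]_k},
    [/\ uniq E, size E = k & {in E, forall Q, linear_set U Q}].
Proof.
move/system_basis=> [t [tU bt]].
exists [seq <[v]>%VS | v <- [seq colv u | u <- t]]; split.
- exact/uniq_free_lines/(basis_free bt).
- by rewrite size_map (size_basis_cV bt).
move=> _ /mapP[_ /mapP[u ut ->] ->]; exists u; split=> //; first exact: tU.
rewrite -colv_eq0; apply: contraTneq (basis_free bt) => u0.
by apply/negP => /free_not0/(_ (map_f _ ut)); rewrite u0 eqxx.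
Qed.

Lemma points_covered_spanned k r (U : {vspace {ffun 'I_k -> L}})
    (v : 'cV[L]_k) :
  points_covered r (linear_set U) -> spanned_by U r.+1 v.
Proof.
(* The zero vector spans no point, so the covering hypothesis does not apply to it. *)
move=> cov; have [->|v0] := eqVneq v 0.
  by exists [::]; split=> //; rewrite mem0v.
have [|s [_ <- sU]] := cov <[v]>%VS; first by rewrite dim_vline v0.
rewrite -memvE => vs.
have [t [st tU defs]] : exists t : seq {ffun 'I_k -> L},
    [/\ (size t <= size s)%N, {subset t <= U}
      & (\sum_(Q <- s) Q)%VS = <<[seq colv u | u <- t]>>%VS].
  elim: s sU {vs} => [|Q s IHs] sU.
    by exists [::]; split=> //; rewrite big_nil span_nil.
  have [|t [st tU defs]] := IHs.
    by move=> P Ps; apply: sU; rewrite inE Ps orbT.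
  have [u [uU _ defQ]] := sU Q (mem_head _ _).
  exists (u :: t); split=> //; last by rewrite big_cons /= span_cons defs defQ.
  by move=> x; rewrite inE => /predU1P[->|/tU].
by exists t; split=> //; rewrite -defs.
Qed.

(** The bound [r < k] guarantees enough distinct points: the linear set has [k] independent ones. *)
Lemma spanned_points_covered n k r (U : {vspace {ffun 'I_k -> L}}) :
  is_system n U -> (r < k)%N -> (forall v, spanned_by U r.+1 v) ->
  points_covered r (linear_set U).
Proof.
move=> sysU rk Ur P dimP; have [E [uE sE EU]] := system_points sysU.
have [v defP] : exists v, P = <[v]>%VS.
  exists (vpick P); apply/esym/eqP; rewrite eqEdim -memvE memv_pick dimP.
  by rewrite dim_vline vpick0 -dimv_eq0 dimP.
have [t [tr tU vt]] := Ur v.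
(* Zero vectors give no point and proportional ones the same point, so [s] may be too short and is
   padded from [E]. *)
pose s := undup [seq <[colv u]>%VS | u <- t & u != 0].
have sr : (size s <= r.+1 <= size E)%N.
  rewrite sE rk andbT (leq_trans (size_undup _)) // size_map size_filter.
  exact: leq_trans (count_size _ _) tr.
have [s' [us' ss' sub sub']] := uniq_complete (undup_uniq _) uE sr.
exists s'; split=> // [Q /sub'|].
  rewrite mem_cat mem_undup => /orP[/mapP[u]|/EU //].
  by rewrite mem_filter => /andP[u0 /tU uU] ->; exists u.
rewrite defP -memvE; apply: subvP vt; apply/span_subvP => _ /mapP[u ut ->].
have [->|u0] := eqVneq u 0.
  by have /eqP -> : colv (0 : {ffun 'I_k -> L}) == 0; rewrite ?colv_eq0 ?mem0v.
have uQ : <[colv u]>%VS \in s'.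
  by apply: sub; rewrite mem_undup (map_f (fun u => <[colv u]>%VS)) // mem_filter u0.
by rewrite memvE (big_rem _ uQ) addvSl.
Qed.

Lemma spanned_by_gt0 k r (U : {vspace {ffun 'I_k -> L}}) :
  (0 < k)%N -> (forall v, spanned_by U r v) -> (0 < r)%N.
Proof.
case: k U => // k U _ Ur; rewrite lt0n; apply/eqP => r0.
have [t []] := Ur (const_mx 1); rewrite r0 leqn0 => /nilP -> _ /=.
rewrite span_nil memv0 => /eqP/matrixP/(_ 0 0)/eqP.
by rewrite !mxE oner_eq0.
Qed.

End Covering.

Local Close Scope ring_scope.

Theorem theorem2p5 (q m n k rho : nat) (F : finFieldType) (L : fieldExtType F)
  (hF : #|F| = q) (hL : \dim (fullv : {vspace L}) = m)
  (hm : 0 < m) (hn : 0 < n) (hk : 0 < k) (hrho : 0 < rho)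
  (C : {vspace 'rV[L]_n}) (hC : \dim C = k) (hCnd : nondegenerate C)
  (U : {vspace {ffun 'I_k -> L}}) (hU : is_system n U)
  (hCU : associated_system C U) :
  rank_saturating rho U <-> rk_covering_radius (dual_code C) = rho.
Proof.
case: hCU => G genG defU; set R := rk_covering_radius _.
have RP r : R <= r <-> forall v, spanned_by U r v.
  by rewrite defU; apply: dual_covering_radius_leP.
have UR : forall v, spanned_by U R v by apply/RP.
have R0 : 0 < R := spanned_by_gt0 hk UR.
have Rk : R <= k by apply/RP => v; apply: system_spanned hU.
(* Index [R.-1] means [R] points; [R0] makes the predecessor exact. *)
have covR : points_covered R.-1 (linear_set U).
  by apply: (spanned_points_covered hU); rewrite prednK.
have leR r : points_covered r (linear_set U) -> R <= r.+1.
  by move=> cov; apply/RP => v; apply: points_covered_spanned.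
split=> [[cov min]|<-]; last first.
  by split=> // r /leR; rewrite -{1}(prednK R0).
(* [leR] at [rho.-1] gives [R <= rho]; minimality of [rho.-1] against [covR] gives the converse. *)
apply/eqP; rewrite eqn_leq -{1}(prednK hrho) leR //=.
by rewrite -(prednK hrho) -(prednK R0) ltnS min.
Qed.
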